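(* Let $G$ be a finite simple graph with connected components $B_1,\dots,B_k$. Then \[ \varphi(G)=\sum_{i=1}^k\varphi(B_i)-(k-1). \]
   Context: Two sets overlap if they intersect and neither is a subset of the other. An overlap representation of a graph $G=(V,E)$ is a family (multiset) of sets $\{S_v : v\in V\}$ such that for all $u,v\in V$, $(u,v)\in E$ iff $S_u\cap S_v\neq\emptyset$, $S_u\not\subseteq S_v$ and $S_v\not\subseteq S_u$; its size is $|\bigcup_{v} S_v|$, and the overlap number $\varphi(G)$ is the minimum size of an overlap representation of $G$.
   Formalization: The sets of a representation are required to be nonempty (this changes φ only for edgeless graphs) and G has at least one vertex; with empty sets allowed the formula fails, e.g. for K_2 + K_1: 3 versus 3 + 0 − 1, and for k = 0 it would read 0 = 1. *)

(* Defs.v *)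
From HB Require Import structures.
From mathcomp Require Import all_boot all_order all_algebra.

Set Implicit Arguments.
Unset Strict Implicit.
Unset Printing Implicit Defensive.

Record sgraph := SGraph {
  svertex :> finType;
  sedge : rel svertex;
  sedge_sym : symmetric sedge;
  sedge_irr : irreflexive sedge
}.

Definition induced_edge (G : sgraph) (B : {set G}) : rel {x : G | x \in B} :=
  fun x y => sedge (val x) (val y).

Lemma induced_sym (G : sgraph) (B : {set G}) : symmetric (@induced_edge G B).
Proof. by move=> x y; exact: sedge_sym. Qed.

Lemma induced_irr (G : sgraph) (B : {set G}) : irreflexive (@induced_edge G B).
Proof. by move=> x; exact: sedge_irr. Qed.

Definition induced (G : sgraph) (B : {set G}) : sgraph :=
  SGraph (@induced_sym G B) (@induced_irr G B).

Definition components (G : sgraph) : {set {set G}} :=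
  equivalence_partition (connect (@sedge G)) [set: G].

Definition overlap (T : finType) (A B : {set T}) : bool :=
  [&& A :&: B != set0, ~~ (A \subset B) & ~~ (B \subset A)].

Definition overlap_rep (G : sgraph) (T : finType) (S : G -> {set T}) : bool :=
  [forall u, forall v, sedge u v == overlap (S u) (S v)].

Definition rep_size (G : sgraph) (T : finType) (S : G -> {set T}) : nat :=
  #|\bigcup_(v : G) S v|.

Definition nonempty_sets (G : sgraph) (T : finType) (S : G -> {set T}) : bool :=
  [forall v, S v != set0].

(* The sets of a representation are required to be nonempty. The requirement  *)
(* affects edgeless graphs only (overlap_number_min_edge): if G has an edge,  *)
(* an empty set can be replaced by a singleton at no cost. Were empty sets    *)
(* allowed, an edgeless graph would have overlap number 0 and the overlap     *)
(* number would not satisfy the formula for components: K_2 + K_1 would give  *)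
(* 3 against 3 + 0 - 1.                                                       *)
(* A representation of size n may be relabelled so that its ground set is     *)
(* 'I_n; overlap_number_attained and overlap_number_min state minimality over *)
(* all ground sets.                                                           *)
Definition representable (G : sgraph) (n : nat) : bool :=
  [exists S : {ffun G -> {set 'I_n}},
    [&& overlap_rep S, nonempty_sets S & rep_size S == n]].

Lemma overlap_repP (G : sgraph) (T : finType) (S : G -> {set T}) :
  reflect (forall u v, sedge u v = overlap (S u) (S v)) (overlap_rep S).
Proof.
apply: (iffP forallP) => [H u v | H u]; first by move/forallP/(_ v)/eqP: (H u).
by apply/forallP => v; rewrite H.
Qed.

Lemma representable_of (G : sgraph) (T : finType) (S : G -> {set T}) :
  overlap_rep S -> nonempty_sets S -> representable G (rep_size S).
Proof.
move=> /overlap_repP rS /forallP nS; rewrite /rep_size.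
set U := \bigcup_(v : G) S v.
pose f (i : 'I_#|U|) : T := enum_val i.
have finj : injective f by exact: enum_val_inj.
have SU v x : x \in S v -> exists i, x = f i.
  move=> xS; have xU : x \in U by apply/bigcupP; exists v.
  by exists (enum_rank_in xU x); rewrite /f enum_rankK_in.
pose S' := [ffun v => f @^-1: S v].
have sub u v : (S' u \subset S' v) = (S u \subset S v).
  rewrite !ffunE; apply/subsetP/subsetP => [H x xu | H i].
    have [i Ei] := SU _ _ xu; have := H i; rewrite !inE -Ei; exact.
  by rewrite !inE; exact: H.
have E0 (A : {set T}) v : A \subset S v -> (f @^-1: A == set0) = (A == set0).
  move=> AS; apply/eqP/eqP => [H | ->]; last by apply/setP => i; rewrite !inE.
  apply/setP => x; rewrite inE; apply/negP => xA.
  have [i Ei] := SU _ _ (subsetP AS _ xA).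
  by move/setP/(_ i): H; rewrite !inE -Ei xA.
apply/existsP; exists S'; apply/and3P; split.
- apply/overlap_repP => u v; rewrite rS /overlap !sub !ffunE -preimsetI.
  by rewrite (@E0 _ u) ?subsetIl.
- by apply/forallP => v; rewrite ffunE (@E0 _ v).
- rewrite /rep_size (_ : \bigcup_(v : G) S' v = [set: 'I_#|U|]) ?cardsT ?card_ord //.
  apply/setP => i; rewrite inE; apply/bigcupP.
  have /bigcupP[v _ iv] : f i \in U by exact: enum_valP.
  by exists v => //; rewrite ffunE inE.
Qed.

Lemma representable_ex (G : sgraph) : exists n, representable G n.
Proof.
pose S (v : G) : {set {set G}} := [set v] |: [set [set v; u] | u in [pred u | sedge v u]].
have S1 v u : ([set v] \in S u) = (v == u).
  apply/idP/eqP => [|->]; last by rewrite !inE eqxx.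
  rewrite !inE => /orP[/eqP/set1_inj //|/imsetP[w /=]].
  rewrite inE => uw E.
  have /eqP : #|[set v]| = #|[set u; w]| by rewrite E.
  by rewrite cards1 cards2; case: (eqVneq u w) uw => [->|//]; rewrite sedge_irr.
exists (rep_size S); apply: representable_of; last first.
  by apply/forallP => v; apply/set0Pn; exists [set v]; rewrite S1.
apply/overlap_repP => u v.
have sub a b : (S a \subset S b) = (a == b).
  apply/idP/eqP => [/subsetP/(_ [set a])|-> //]; rewrite !S1 eqxx.
  by move=> /(_ isT)/eqP.
rewrite /overlap !sub [v == u]eq_sym andbb.
have [->|nuv] := eqVneq u v; first by rewrite sedge_irr andbF.
rewrite andbT; apply/idP/set0Pn => [uv|[X /setIP[]]].
  exists [set u; v]; apply/setIP; split; apply/setU1P; right.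
    exact: imset_f.
  by rewrite setUC; apply: imset_f; rewrite inE sedge_sym.
case/setU1P => [EX Xv|/imsetP[w /=]]; first by move: Xv; rewrite EX S1 (negPf nuv).
rewrite inE => uw ->.
case/setU1P => [E|/imsetP[z /= _ E]].
  by move/setP/(_ u): E; rewrite !inE eqxx (negPf nuv).
have : v \in [set u; w] by rewrite E !inE eqxx.
by rewrite !inE eq_sym (negPf nuv) /= => /eqP->.
Qed.

Definition overlap_number (G : sgraph) : nat := ex_minn (representable_ex G).

Lemma overlap_number_attained (G : sgraph) :
  exists (T : finType) (S : G -> {set T}),
    [/\ overlap_rep S, nonempty_sets S & rep_size S = overlap_number G].
Proof.
rewrite /overlap_number; case: ex_minnP => n /existsP[S /and3P[rS nS /eqP sS]] _.
by exists 'I_n, S.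
Qed.

Lemma overlap_number_min (G : sgraph) (T : finType) (S : G -> {set T}) :
  overlap_rep S -> nonempty_sets S -> overlap_number G <= rep_size S.
Proof.
move=> rS nS; rewrite /overlap_number; case: ex_minnP => n _; apply.
exact: representable_of.
Qed.

Lemma overlap_number_min_edge (G : sgraph) (a b : G) (T : finType)
    (S : G -> {set T}) :
  sedge a b -> overlap_rep S -> overlap_number G <= rep_size S.
Proof.
move=> ab /overlap_repP rS.
have /set0Pn[x] : S a :&: S b != set0 by move: ab; rewrite rS => /and3P[].
rewrite inE => /andP[xa _].
pose S' v := if S v == set0 then [set x] else S v.
have o1 (A : {set T}) : overlap [set x] A = false.
  rewrite /overlap sub1set; case xA: (x \in A); rewrite ?andbF //.
  by rewrite (_ : [set x] :&: A = set0) ?eqxx //; apply/eqP; rewrite setI_eq0 disjoints1 xA.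
have oC (A B : {set T}) : overlap A B = overlap B A.
  by rewrite /overlap setIC [_ && ~~ (_ \subset _)]andbC.
have o0 (A : {set T}) : overlap set0 A = false by rewrite /overlap set0I eqxx.
apply: leq_trans (overlap_number_min (S := S') _ _) _.
- apply/overlap_repP => u v; rewrite rS /S'.
  have [->|_] := eqVneq (S u) set0; first by rewrite o0 o1.
  by have [->|_] := eqVneq (S v) set0; first by rewrite oC o0 oC o1.
- apply/forallP => v; rewrite /S'; have [_|//] := eqVneq (S v) set0.
  by apply/set0Pn; exists x; rewrite inE.
- apply: subset_leq_card; apply/bigcupsP => v _; rewrite /S'.
  have [_|_] := eqVneq (S v) set0; last exact: bigcup_sup.
  by rewrite sub1set; apply/bigcupP; exists a.
Qed.

(* Main.v *)
(** Upper bound: representations of two graphs are merged by substituting the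
    whole ground set of one for a single point of the other, which saves one
    point and creates no overlap between the two families.

    Lower bound: in a representation of G, a set of one component that lies
    inside a set S_w of another component drags its whole component inside S_w.
    Hence, if no component is a single vertex, the component B with the smallest
    union U_B is such that every set of the other components contains U_B or is
    disjoint from it. Contracting U_B to one point therefore represents the
    remaining components with |U_B| - 1 fewer points, and |U_B| is at least the
    overlap number of B. A single-vertex component contributes 1 - 1 to the
    formula and can just be dropped. *)

Require Import Defs.
From mathcomp Require Import all_boot all_order all_algebra.
From mathcomp Require Import zify.

Set Implicit Arguments.
Unset Strict Implicit.
Unset Printing Implicit Defensive.

(** * Overlap of two sets through witness points and maps *)

Lemma overlapP (T : finType) (A B : {set T}) :
  reflect (exists x y z, [/\ (x \in A) && (x \in B), (y \in A) && (y \notin B)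
                           & (z \notin A) && (z \in B)])
          (overlap A B).
Proof.
apply: (iffP and3P) => [[/set0Pn[x]] | [x [y [z [Hx Hy Hz]]]]].
  rewrite inE => Hx /subsetPn[y yA yB] /subsetPn[z zB zA].
  by exists x, y, z; rewrite Hx yA yB zA zB.
split; first by apply/set0Pn; exists x; rewrite inE.
  by case/andP: Hy => yA yB; apply/subsetPn; exists y.
by case/andP: Hz => zA zB; apply/subsetPn; exists z.
Qed.

(** Overlap depends only on which membership patterns occur: in both sets, in the first alone, in
    the second alone. Carrying each pattern to a point of the other ground set is therefore
    enough. *)
Lemma overlap_transfer (T T' : finType) (A B : {set T}) (A' B' : {set T'}) :
  (forall t, t \in A :|: B ->
     exists t', (t' \in A') = (t \in A) /\ (t' \in B') = (t \in B)) ->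
  overlap A B -> overlap A' B'.
Proof.
move=> H /overlapP[x [y [z [Hx Hy Hz]]]].
have [|x' [xA xB]] := H x; first by case/andP: Hx => xA _; rewrite inE xA.
have [|y' [yA yB]] := H y; first by case/andP: Hy => yA _; rewrite inE yA.
have [|z' [zA zB]] := H z.
  by case/andP: Hz => _ zB; rewrite inE zB orbT.
by apply/overlapP; exists x', y', z'; rewrite xA xB yA yB zA zB.
Qed.

Lemma overlapC (T : finType) (A B : {set T}) : overlap A B = overlap B A.
Proof. by rewrite /overlap setIC [_ && ~~ (_ \subset _)]andbC. Qed.

Lemma overlap_subset (T : finType) (A B : {set T}) :
  A \subset B -> overlap A B = false.
Proof. by rewrite /overlap => ->; rewrite andbF. Qed.

Lemma overlap_disjoint (T : finType) (A B : {set T}) :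
  [disjoint A & B] -> overlap A B = false.
Proof. by rewrite /overlap -setI_eq0 => ->. Qed.

Lemma overlap_imset (T T' : finType) (f : T -> T') (A B : {set T}) :
  injective f -> overlap (f @: A) (f @: B) = overlap A B.
Proof.
move=> finj; apply/idP/idP; apply: overlap_transfer => t.
  rewrite -imsetU => /imsetP[s _ ->].
  by exists s; rewrite !mem_imset.
by move=> _; exists (f t); rewrite !mem_imset.
Qed.

Lemma overlap_preimset (T T' : finType) (f : T' -> T) (A B : {set T}) :
  (forall t, exists t', f t' = t) ->
  overlap (f @^-1: A) (f @^-1: B) = overlap A B.
Proof.
move=> fsurj; apply/idP/idP; apply: overlap_transfer => t _.
  by exists (f t); rewrite !inE.
by have [t' <-] := fsurj t; exists t'; rewrite !inE.
Qed.

(** * Connected components and representations restricted to them *)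

Section Components.

Variable G : sgraph.
Implicit Types (B C : {set G}) (D : {set {set G}}).

Lemma componentE B u : B \in components G -> u \in B ->
  forall v, (v \in B) = connect (@sedge G) u v.
Proof.
have sC : connect_sym (@sedge G) by apply: sym_connect_sym; exact: sedge_sym.
case/imsetP => x _ -> /[!inE] /= xu v; rewrite !inE /=.
exact: (same_connect sC xu).
Qed.

Lemma component_neq0 B : B \in components G -> exists u, u \in B.
Proof. by case/imsetP => x _ ->; exists x; rewrite !inE connect0. Qed.

Lemma component_eq B C u :
  B \in components G -> C \in components G -> u \in B -> u \in C -> B = C.
Proof.
move=> HB HC uB uC; apply/setP => v.
by rewrite (componentE HB uB) (componentE HC uC).
Qed.

Lemma component_edge B u v :
  B \in components G -> u \in B -> sedge u v -> v \in B.
Proof. by move=> HB uB uv; rewrite (componentE HB uB) connect1. Qed.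

Lemma component_neighbour B u :
  B \in components G -> u \in B -> 1 < #|B| -> exists2 v, v \in B & sedge u v.
Proof.
move=> HB uB; rewrite (cardsD1 u) uB ltnS => /card_gt0P[w].
rewrite !inE => /andP[wu]; rewrite (componentE HB uB) => /connectP[[|v p] /=].
  by move=> _ E; rewrite E eqxx in wu.
by case/andP=> uv _ _; exists v => //; exact: component_edge uv.
Qed.

Lemma cover_components : cover (components G) = [set: G].
Proof.
apply/setP => v; rewrite inE; apply/bigcupP.
by exists [set y in [set: G] | connect (@sedge G) v y];
  [exact: imset_f | rewrite !inE connect0].
Qed.

(** The family stays indexed by all of [G] and is constrained on [A] only, so components can be
    added or removed without changing the index type. *)
Definition overlap_rep_on (A : {set G}) (T : finType) (S : G -> {set T}) :=
  {in A &, forall u v, sedge u v = overlap (S u) (S v)}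
  /\ {in A, forall v, S v != set0}.

Lemma overlap_number_induced_le (T : finType) B (S : G -> {set T}) :
  overlap_rep_on B S -> overlap_number (induced B) <= #|\bigcup_(v in B) S v|.
Proof.
move=> [rS nS].
apply: leq_trans (overlap_number_min (S := fun v : induced B => S (val v)) _ _) _.
- by apply/overlap_repP => u v; rewrite -rS //; exact: valP.
- by apply/forallP => v; apply: nS; exact: (valP v).
- apply: subset_leq_card; apply/bigcupsP => v _.
  by apply: bigcup_sup; exact: (valP v).
Qed.

Lemma overlap_number_induced_attained B :
  exists S : G -> {set 'I_(overlap_number (induced B))}, overlap_rep_on B S.
Proof.
rewrite /overlap_number; case: ex_minnP => n.
case/existsP=> S /and3P[/overlap_repP rS /forallP nS _] _.
pose S' v := if (insub v : option {x : G | x \in B}) is Some w then S w else set0.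
exists S'; rewrite /S'; split=> [u v uB vB | v vB].
  by rewrite (insubT (mem B) uB) (insubT (mem B) vB) -rS.
by rewrite (insubT (mem B) vB) nS.
Qed.

Lemma overlap_number_induced1 B :
  #|B| <= 1 -> overlap_number (induced B) <= 1.
Proof.
move=> B1.
apply: leq_trans (@overlap_number_induced_le unit B (fun=> setT) _) _; last first.
  by rewrite (leq_trans (max_card _)) ?card_unit.
split=> [u v uB vB | v _]; last by apply/set0Pn; exists tt.
by rewrite overlap_subset // (card_le1_eqP B1 _ _ uB vB) sedge_irr.
Qed.

(** Induction on [#|D|], adding one component at a time. The empty [D] starts from a one-point
    ground set, and [0 < #|T|] is carried along to supply the point that the next substitution
    replaces. *)
Lemma overlap_rep_merge D : D \subset components G ->
  exists (T : finType) (S : G -> {set T}),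
    [/\ overlap_rep_on (cover D) S, 0 < #|T|
      & #|T| + #|D| = (\sum_(B in D) overlap_number (induced B)).+1].
Proof.
elim: {D}_.+1 {-2}D (ltnSn #|D|) => // n IH D; rewrite ltnS => Dn DG.
have [->|[B BD]] := set_0Vmem D.
  exists unit, (fun=> setT); rewrite card_unit cards0 big_set0; split=> //.
  by split=> [u v|v]; rewrite /cover big_set0 inE.
have BG := subsetP DG _ BD.
have D'G : D :\ B \subset components G := subset_trans (subD1set _ _) DG.
have D'n : #|D :\ B| < n by move: Dn; rewrite (cardsD1 B) BD.
have [T1 [S1 [[rS1 nS1] T1_gt0 E1]]] := IH _ D'n D'G.
have [S2 [rS2 nS2]] := overlap_number_induced_attained B.
set T2 := 'I__ in S2 rS2 nS2.
have [b bB] := component_neq0 BG.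
have [z0 _] := set0Pn _ (nS2 b bB).
have [x _] := card_gt0P T1_gt0.
(* The point [x] of [T1] is replaced by a copy of [T2], which [f] collapses back to [x]. Since [T2]
   contains [z0], [f] is onto. *)
pose T := ({y : T1 | y != x} + T2)%type.
pose f (t : T) : T1 := match t with inl y => val y | inr _ => x end.
have fsurj t : exists t', f t' = t.
  have [->|tx] := eqVneq t x; first by exists (inr z0).
  by exists (inl (Sub t tx)).
pose S v : {set T} := if v \in B then inr @: S2 v else f @^-1: S1 v.
have cov v : v \in cover D -> v \notin B -> v \in cover (D :\ B).
  case/bigcupP => C CD vC vB; apply/bigcupP; exists C => //.
  by rewrite !inE CD andbT; apply: contraNneq vB => <-.
(* [S u] lies in the copy of [T2], which [S v] contains if [x \in S1 v] and misses otherwise. *)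
have mixed u v : u \in B -> v \notin B -> sedge u v = overlap (S u) (S v).
  move=> uB vB; rewrite /S uB (negPf vB).
  have -> : sedge u v = false.
    by apply: contraNF vB; exact: component_edge.
  have [xv|xv] := boolP (x \in S1 v); apply/esym.
    by apply: overlap_subset; apply/subsetP => _ /imsetP[z _ ->]; rewrite inE.
  apply: overlap_disjoint; rewrite -setI_eq0; apply/eqP/setP => t.
  rewrite !inE; apply/negP => /andP[/imsetP[z _ ->]] /=.
  by rewrite (negPf xv).
exists T, S; split.
- split=> [u v uD vD | v vD].
    have [uB|uB] := boolP (u \in B); have [vB|vB] := boolP (v \in B).
    + rewrite /S uB vB overlap_imset; [exact: rS2 | exact: inr_inj].
    + exact: mixed.
    + by rewrite sedge_sym overlapC; exact: mixed.
    + rewrite /S (negPf uB) (negPf vB) overlap_preimset //.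
      by apply: rS1; exact: cov.
  rewrite /S; case: ifPn => vB.
    have /set0Pn[z zS] := nS2 v vB.
    by apply/set0Pn; exists (inr z); rewrite imset_f.
  have /set0Pn[z zS] := nS1 v (cov _ vD vB).
  by have [t Et] := fsurj z; apply/set0Pn; exists t; rewrite inE Et.
- by apply/card_gt0P; exists (inr z0).
- have cT : #|{: T}| = #|T1|.-1 + overlap_number (induced B).
    by rewrite card_sum card_sig card_ord (cardC1 x).
  have cD : #|D| = #|D :\ B|.+1 by rewrite (cardsD1 B D) BD.
  rewrite [LHS](congr2 addn cT cD) (big_setD1 B) //=.
  by rewrite addnS addnAC -2!addSn prednK // E1 addSn [in LHS]addnC.
Qed.

(** * Lower bound: nesting of components and contraction *)

(* For v adjacent to u, the sets S v and S w meet in S u, and S w is not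
   included in S v because S u is not. *)
Lemma component_subset (T : finType) B (S : G -> {set T}) u w :
  B \in components G -> u \in B -> w \notin B ->
  overlap_rep_on (w |: B) S ->
  S u \subset S w -> \bigcup_(v in B) S v \subset S w.
Proof.
move=> HB uB wB [rS nS] uw; apply/bigcupsP => v.
rewrite (componentE HB uB) => /connectP[p + ->] {v}.
elim: p u uB uw => [//|v p IH] u uB uw /= /andP[uv]; apply: IH.
  exact: component_edge uv.
have vB := component_edge HB uB uv.
have [uS vS wS] : [/\ u \in w |: B, v \in w |: B & w \in w |: B].
  by rewrite !inE uB vB eqxx !orbT.
have := uv; rewrite rS // => /and3P[/set0Pn[x] + uNv vNu].
rewrite inE => /andP[xu xv].
have : sedge v w = false by apply: contraNF wB; exact: component_edge.
rewrite rS //; apply: contraFT => vNw; apply/and3P; split=> //.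
  by apply/set0Pn; exists x; rewrite inE xv (subsetP uw).
by apply: contra uNv; exact: subset_trans.
Qed.

(** Suppose [S w] meets the union of [B] without containing it, say at a point of [S v]. By
    [component_subset], [S v] is not inside [S w]; being nonadjacent, they satisfy
    [S w \subset S v], which drags all of [C] into [S v]. The size comparison then makes [S v] the
    whole union of [B], so it cannot overlap the set of a neighbour of [v]. *)
Lemma component_laminar (T : finType) B C (S : G -> {set T}) w :
  B \in components G -> C \in components G -> B != C -> 1 < #|B| ->
  overlap_rep_on (B :|: C) S ->
  #|\bigcup_(v in B) S v| <= #|\bigcup_(v in C) S v| -> w \in C ->
  (\bigcup_(v in B) S v \subset S w) || [disjoint \bigcup_(v in B) S v & S w].
Proof.
move=> HB HC BC B1 [rS nS] leU wC; apply/norP => -[BNw].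
rewrite -setI_eq0 => /set0Pn[x] /setIP[/bigcupP[v vB xv] xw].
have wB : w \notin B by apply: contra BC => /(component_eq HB HC) ->.
have vC : v \notin C by apply: contra BC => /(component_eq HB HC) ->.
have vS : v \in B :|: C by rewrite inE vB.
have wS : w \in B :|: C by rewrite inE wC orbT.
have rep_on (A : {set G}) : A \subset B :|: C -> overlap_rep_on A S.
  by move=> /subsetP sA; split=> [a b aA bA|a aA]; [apply: rS|apply: nS]; exact: sA.
have vNw : ~~ (S v \subset S w).
  apply: contra BNw; apply: component_subset => //; apply: rep_on.
  by rewrite subUset sub1set wS subsetUl.
have wv : S w \subset S v.
  have : sedge v w = false by apply: contraNF wB; exact: component_edge.
  rewrite rS //; apply: contraFT => wNv; apply/and3P; split=> //.
  by apply/set0Pn; exists x; rewrite inE xv.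
have CSv : \bigcup_(u in C) S u \subset S v.
  apply: component_subset wv => //; apply: rep_on.
  by rewrite subUset sub1set vS subsetUr.
have [v' v'B vv'] := component_neighbour HB vB B1.
have v'S : v' \in B :|: C by rewrite inE v'B.
have := vv'; rewrite rS // => /and3P[_ _ /negP]; apply.
have/eqP -> : S v == \bigcup_(u in B) S u.
  by rewrite eqEcard bigcup_sup //= (leq_trans leU) // subset_leq_card.
exact: bigcup_sup.
Qed.

(** Taking any nonempty [X] above the union, rather than the union itself, settles the empty [D] and
    lets [X] stay fixed when a single vertex is dropped. *)
Lemma sum_overlap_number_le (T : finType) D (S : G -> {set T}) (X : {set T}) :
  D \subset components G -> overlap_rep_on (cover D) S ->
  0 < #|X| -> \bigcup_(v in cover D) S v \subset X ->
  (\sum_(B in D) overlap_number (induced B)).+1 <= #|X| + #|D|.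
Proof.
elim: {D}_.+1 {-2}D (ltnSn #|D|) S X => // n IH D + S X.
rewrite ltnS => Dn DG [rS nS] X_gt0 SX.
have [->|[B0 B0D]] := set_0Vmem D; first by rewrite cards0 addn0 big_set0.
have SvX v : v \in cover D -> S v \subset X.
  by move=> vD; apply: subset_trans SX; exact: bigcup_sup.
have subD B : D :\ B \subset components G := subset_trans (subD1set _ _) DG.
have D'n B : B \in D -> #|D :\ B| < n by move=> BD; move: Dn; rewrite (cardsD1 B) BD.
have covS B : cover (D :\ B) \subset cover D.
  apply/bigcupsP => C; rewrite !inE => /andP[_ CD]; exact: bigcup_sup.
have [/existsP[B /andP[BD B1]]|] := boolP [exists B in D, #|B| <= 1].
  have repB : overlap_rep_on (cover (D :\ B)) S.
    by split=> [u v uD vD|v vD]; [apply: rS|apply: nS]; exact: (subsetP (covS B)).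
  have SX' : \bigcup_(v in cover (D :\ B)) S v \subset X.
    by apply/bigcupsP => v vD; apply: SvX; exact: (subsetP (covS B)).
  rewrite (cardsD1 B D) BD (big_setD1 B BD) -addnS addnCA.
  apply: leq_add; first exact: overlap_number_induced1.
  exact: IH (D'n _ BD) S X (subD B) repB X_gt0 SX'.
rewrite negb_exists_in => /forall_inP big.
pose U B := \bigcup_(v in B) S v.
case: (arg_minnP (fun B => #|U B|) B0D) => B; rewrite -[_ B]/(B \in D) => BD minB.
have BG := subsetP DG _ BD.
have B1 : 1 < #|B| by rewrite ltnNge big.
have inD C v : C \in D -> v \in C -> v \in cover D.
  by move=> CD vC; apply/bigcupP; exists C.
have UX : U B \subset X by apply/bigcupsP => v vB; apply: SvX; exact: inD vB.
have lam w : w \in cover (D :\ B) -> (U B \subset S w) || [disjoint U B & S w].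
  case/bigcupP => C; rewrite !inE => /andP[CB CD] wC.
  apply: (@component_laminar _ B C) => //; rewrite ?(subsetP DG) 1?eq_sym //.
    split=> [a b|a]; rewrite !inE.
      move=> aBC bBC; apply: rS.
        by case/orP: aBC; [exact: (inD B) | exact: (inD C)].
      by case/orP: bBC; [exact: (inD B) | exact: (inD C)].
    by move=> /orP[] Ha; apply: nS; [exact: (inD B) | exact: (inD C)].
  exact: minB.
have [b bB] := component_neq0 BG.
have /set0Pn[x xb] := nS b (inD B b BD bB).
have xU : x \in U B by apply/bigcupP; exists b.
(* Intersecting with [Y] contracts [U B] to [x], and [g] is the contraction map. By [lam], each
   remaining [S w] contains or misses [U B], so [g] preserves membership in it. *)
pose Y := ~: (U B :\ x).
pose S' w := S w :&: Y.
pose g t := if t \in U B then x else t.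
have gY t : g t \in Y.
  by rewrite /g; case: ifPn => tU; rewrite !inE ?eqxx // (negPf tU) andbF.
have gS w t : w \in cover (D :\ B) -> (g t \in S w) = (t \in S w).
  move=> /lam Hw; rewrite /g; case: ifP => // tU.
  case/orP: Hw => [/subsetP UB|dis]; first by rewrite !UB.
  by rewrite !(disjointFr dis).
have rep' : overlap_rep_on (cover (D :\ B)) S'.
  split=> [u v uD vD|v vD].
    rewrite rS ?(subsetP (covS B)) //.
    apply/idP/idP; apply: overlap_transfer => t.
      by move=> _; exists (g t); rewrite /S' !(in_setI _ _ Y) gY !andbT !gS.
    rewrite /S' -setIUl => /setIP[_ tY].
    by exists t; rewrite !(in_setI _ _ Y) tY !andbT.
  have /set0Pn[t tS] := nS v (subsetP (covS B) _ vD).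
  by apply/set0Pn; exists (g t); rewrite in_setI gY gS // tS.
have X'_gt0 : 0 < #|X :&: Y|.
  by apply/card_gt0P; exists x; rewrite !inE eqxx (subsetP UX).
have SX' : \bigcup_(v in cover (D :\ B)) S' v \subset X :&: Y.
  by apply/bigcupsP => v vD; apply: setSI; apply: SvX; exact: (subsetP (covS B)).
have cX : #|X :&: Y| + #|U B| = #|X|.+1.
  rewrite -(cardsID (U B :\ x) X) -setDE.
  rewrite (setIidPr (subset_trans (subD1set _ _) UX)) (cardsD1 x (U B)) xU; lia.
rewrite (cardsD1 B D) BD (big_setD1 B BD) -addnS addnA addn1 -cX addnAC addnC.
apply: leq_add; first exact: IH (D'n _ BD) S' _ (subD B) rep' X'_gt0 SX'.
apply: overlap_number_induced_le; split=> [u v uB vB|v vB].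
  by apply: rS; [exact: inD uB | exact: inD vB].
by apply: nS; exact: inD vB.
Qed.

End Components.

Lemma overlap_number_components (G : sgraph) : 0 < #|G| ->
  overlap_number G + #|components G| =
    (\sum_(B in components G) overlap_number (induced B)).+1.
Proof.
case/card_gt0P => v0 _; apply/eqP; rewrite eqn_leq; apply/andP; split.
  have [T [S [[rS nS] _ <-]]] := overlap_rep_merge (subxx (components G)).
  rewrite leq_add2r; rewrite cover_components in rS nS.
  apply: leq_trans (overlap_number_min (S := S) _ _) _.
  - by apply/overlap_repP => u v; apply: rS.
  - by apply/forallP => v; apply: nS.
  - exact: max_card.
have [T [S [/overlap_repP rS /forallP nS <-]]] := overlap_number_attained G.
apply: (@sum_overlap_number_le _ _ _ S) => //.
  by split=> [u v _ _|v _]; [exact: rS | exact: nS].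
  (* The vertex [v0] makes the union nonempty; for the empty graph the identity would read 0 = 1. *)
  have /set0Pn[x xS] := nS v0.
  by apply/card_gt0P; exists x; apply/bigcupP; exists v0.
by apply/bigcupsP => v _; exact: bigcup_sup.
Qed.

Local Open Scope ring_scope.

Theorem theorem17 (G : sgraph) (G_nonempty : (0 < #|G|)%N) :
  (overlap_number G)%:Z =
    \sum_(B in components G) (overlap_number (induced B))%:Z
      - (#|components G|%:Z - 1).
Proof.
have := overlap_number_components G_nonempty.
rewrite -(big_morph Posz PoszD (erefl (Posz 0))); lia.
Qed.
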